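(* The following relations hold in $U_q(\mathfrak{sl}_2)$: \begin{align*} x^2 \nu_x &= q^{-1} x^2 - q^{-1} + q^2 \nu_y + q^{-2}\nu_z - q\nu_y\nu_z,\\ y^2 \nu_y &= q^{-1} y^2 - q^{-1} + q^2 \nu_z + q^{-2}\nu_x - q\nu_z\nu_x,\\ z^2 \nu_z &= q^{-1} z^2 - q^{-1} + q^2 \nu_x + q^{-2}\nu_y - q\nu_x\nu_y,\\ \nu_x x^2 &= q^{-1}x^2 - q^{-1}+q^{-2}\nu_y + q^2\nu_z - q\nu_y\nu_z, \\ \nu_y y^2 &= q^{-1}y^2 - q^{-1}+q^{-2}\nu_z + q^2\nu_x - q\nu_z\nu_x, \\ \nu_z z^2 &= q^{-1}z^2 - q^{-1}+q^{-2}\nu_x + q^2\nu_y - q\nu_x\nu_y. \end{align*}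
   Context: $\mathbb K$ is a field and $q$ is a nonzero scalar in $\mathbb K$ with $q^2\neq 1$. $U_q(\mathfrak{sl}_2)$ is the unital associative $\mathbb K$-algebra with generators $x,y,y^{-1},z$ and relations $yy^{-1}=y^{-1}y=1$, $\frac{qxy-q^{-1}yx}{q-q^{-1}}=1$, $\frac{qyz-q^{-1}zy}{q-q^{-1}}=1$, $\frac{qzx-q^{-1}xz}{q-q^{-1}}=1$. In $U_q(\mathfrak{sl}_2)$: $\nu_x=q(1-yz)=q^{-1}(1-zy)$, $\nu_y=q(1-zx)=q^{-1}(1-xz)$, $\nu_z=q(1-xy)=q^{-1}(1-yx)$. *)

(* Defs.v *)
From HB Require Import structures.
From mathcomp Require Import all_boot all_order all_algebra.
From mathcomp Require Import boolp generic_quotient ring_quotient.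
From mathcomp Require Import monalg.

Set Implicit Arguments.
Unset Strict Implicit.
Unset Printing Implicit Defensive.

Import GRing.Theory.

Local Open Scope ring_scope.
Local Open Scope quotient_scope.

(* The free unital associative K-algebra on n letters, as the monoid algebra  *)
(* of the free (noncommutative) monoid of words.                              *)
Definition freealg (K : fieldType) (n : nat) : Type := {malg K[{fmonom 'I_n}]}.

HB.instance Definition _ (K : fieldType) (n : nat) :=
  GRing.Lalgebra.on (freealg K n).

Lemma freealg_scaleAr (K : fieldType) (n : nat) (c : K) (g h : freealg K n) :
  c *: (g * h) = g * (c *: h).
Proof.
have cC (f : {malg K[{fmonom 'I_n}]}) : f * c%:MP = c *: f.
  rewrite malgM_def malgZ_def fgmulgU /fgscale.
  by apply/eq_bigr => k _; rewrite mulrC mulm1.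
by rewrite -[in LHS]cC -[c *: h]cC mulrA.
Qed.

HB.instance Definition _ (K : fieldType) (n : nat) :=
  GRing.Lalgebra_isAlgebra.Build K (freealg K n) (@freealg_scaleAr K n).

Definition letter (K : fieldType) (n : nat) (i : 'I_n) : freealg K n :=
  << fmu i >>.

Section Evaluation.
Variables (K : fieldType) (n : nat) (A : algType K) (f : 'I_n -> A).

Definition word_eval (m : {fmonom 'I_n}) : A := \prod_(i <- m) f i.

Lemma word_eval_morph : mmorphism word_eval.
Proof.
by split => [m1 m2|]; rewrite /word_eval ?fmM ?big_cat // fm1 big_nil.
Qed.

HB.instance Definition _ :=
  isMultiplicative.Build {fmonom 'I_n} A word_eval word_eval_morph.

Definition fa_eval : freealg K n -> A := mmap (in_alg A) word_eval.

HB.instance Definition _ := GRing.Additive.copy fa_eval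
  (mmap (in_alg A) word_eval : {malg K[{fmonom 'I_n}]} -> A).

Lemma fa_eval_mul : monoid_morphism fa_eval.
Proof.
suff [] : multiplicative fa_eval by [].
apply: commr_mmap_is_multiplicative => g m m' /=.
by rewrite /GRing.comm mulr_algl mulr_algr.
Qed.

HB.instance Definition _ :=
  GRing.isMonoidMorphism.Build (freealg K n) A fa_eval fa_eval_mul.

Lemma fa_eval_scale : scalable fa_eval.
Proof. by move=> c g; rewrite /fa_eval mmapZ /= mulr_algl. Qed.

HB.instance Definition _ :=
  GRing.isScalable.Build K (freealg K n) A *:%R fa_eval fa_eval_scale.

Lemma fa_eval_letter (i : 'I_n) : fa_eval (letter K i) = f i.
Proof. by rewrite /fa_eval mmapU /= scale1r mul1r /word_eval fmU big_seq1. Qed.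

End Evaluation.

Inductive two_sided_ideal (R : nzRingType) (S : R -> Prop) : R -> Prop :=
| tsi_gen a of S a : two_sided_ideal S a
| tsi_0 : two_sided_ideal S 0
| tsi_sub a b of two_sided_ideal S a & two_sided_ideal S b :
    two_sided_ideal S (a - b)
| tsi_mul r a s of two_sided_ideal S a : two_sided_ideal S (r * a * s).

Section Uq.
Variables (K : fieldType) (q : K).

Section Relations.
Variables (A : algType K) (x y yi z : A).

Definition q_comm (a b : A) : A :=
  (q - q^-1)^-1 *: (q *: (a * b) - q^-1 *: (b * a)).

Definition Uq_relators : seq A :=
  [:: y * yi - 1; yi * y - 1;
      q_comm x y - 1; q_comm y z - 1; q_comm z x - 1].

End Relations.

Lemma morph_q_comm (A B : algType K) (phi : {lrmorphism A -> B}) (a b : A) :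
  phi (q_comm a b) = q_comm (phi a) (phi b).
Proof. by rewrite /q_comm linearZ_LR linearB /= !(linearZ_LR phi) !rmorphM. Qed.

Lemma morph_relators (A B : algType K) (phi : {lrmorphism A -> B})
    (x y yi z : A) :
  map phi (Uq_relators x y yi z) =
    Uq_relators (phi x) (phi y) (phi yi) (phi z).
Proof.
by rewrite /Uq_relators -!morph_q_comm -!rmorphM -(rmorph1 phi) -!rmorphB.
Qed.

Definition Uq_presentation : seq (freealg K 4) :=
  Uq_relators (letter K (inord 0)) (letter K (inord 1))
              (letter K (inord 2)) (letter K (inord 3)).

Definition Uq_ideal : {pred freealg K 4} :=
  fun a => `[< two_sided_ideal (fun r => r \in Uq_presentation) a >].

Lemma Uq_ideal_zmod : zmod_closed Uq_ideal.
Proof.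
split=> [|a b /asboolP Ia /asboolP Ib]; apply/asboolP; first exact: tsi_0.
exact: tsi_sub.
Qed.

HB.instance Definition _ :=
  GRing.isZmodClosed.Build (freealg K 4) Uq_ideal Uq_ideal_zmod.

Lemma Uq_ideal_mul r a s : a \in Uq_ideal -> r * a * s \in Uq_ideal.
Proof. by move=> /asboolP Ia; apply/asboolP/tsi_mul. Qed.

Lemma fa_eval_ideal (A : algType K) (f : 'I_4 -> A) (a : freealg K 4) :
  (forall r, r \in Uq_relators (f (inord 0)) (f (inord 1))
                               (f (inord 2)) (f (inord 3)) -> r = 0) ->
  a \in Uq_ideal -> fa_eval f a = 0.
Proof.
move=> f0 /asboolP; elim=> {a} [a aP||a b _ ea _ eb|r a s _ ea].
- by apply: f0; rewrite -!(fa_eval_letter f) -morph_relators; apply: map_f.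
- exact: raddf0.
- by rewrite raddfB /= ea eb subrr.
- by rewrite !rmorphM /= ea mulr0 mul0r.
Qed.

Hypotheses (hq : q != 0) (hq2 : q ^+ 2 != 1).

Lemma q_sub_inv_neq0 : q - q^-1 != 0.
Proof.
by apply: contra hq2; rewrite subr_eq0 => /eqP e; rewrite expr2 {2}e divff.
Qed.

(* The counit x, y, y^-1, z |-> 1 shows that the relations are consistent. *)
Lemma Uq_ideal1 : 1 \notin Uq_ideal.
Proof.
have qc : q_comm (1 : K^o) 1 = 1.
  rewrite /q_comm !mulr1 -scalerBl scalerA mulVf ?q_sub_inv_neq0 //.
  exact: scale1r.
apply/negP => /(@fa_eval_ideal K^o (fun=> 1)) I1.
suff /I1 : forall r, r \in Uq_relators (1 : K^o) 1 1 1 -> r = 0.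
  by rewrite rmorph1 => /eqP; rewrite oner_eq0.
by move=> r; rewrite !inE qc mulr1 subrr !orbb => /eqP.
Qed.

(* The proofs hq and hq2 are parameters because algType requires 1 != 0, which *)
(* fails in the presented algebra when q = 0 or q^2 = 1, since 0^-1 = 0.       *)
Definition Uq of q != 0 & q ^+ 2 != 1 : Type := Quotient.quot Uq_ideal.
Local Notation U := (Uq hq hq2).

HB.instance Definition _ := GRing.Zmodule.on U.
HB.instance Definition _ := EqQuotient.on U.

Definition Uq_pi : freealg K 4 -> U := \pi_U.

Lemma Uq_piP a b : reflect (Uq_pi a = Uq_pi b) (a - b \in Uq_ideal).
Proof. by rewrite Quotient.idealrBE; apply: eqP. Qed.

Lemma Uq_pi_surj (u : U) : exists a, u = Uq_pi a.
Proof. by exists (repr u); rewrite /Uq_pi reprK. Qed.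

Definition Uq_one : U := Uq_pi 1.
Definition Uq_mul (u v : U) : U := Uq_pi (repr u * repr v).
Definition Uq_scale (c : K) (u : U) : U := Uq_pi (c *: repr u).

Lemma Uq_pi_add : {morph Uq_pi : a b / a + b}.
Proof. by move=> a b; rewrite /Uq_pi Quotient.pi_add. Qed.

Lemma Uq_pi_repr a : a - repr (Uq_pi a) \in Uq_ideal.
Proof. by apply/Uq_piP; rewrite [RHS]reprK. Qed.

Lemma Uq_pi_mul a b : Uq_pi (a * b) = Uq_mul (Uq_pi a) (Uq_pi b).
Proof.
apply/Uq_piP; set a' := repr _; set b' := repr _.
have -> : a * b - a' * b' = 1 * (a - a') * b + a' * (b - b') * 1.
  by rewrite mul1r mulr1 mulrBl mulrBr addrA subrK.
by rewrite rpredD // Uq_ideal_mul // Uq_pi_repr.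
Qed.

Lemma Uq_pi_scale c a : Uq_pi (c *: a) = Uq_scale c (Uq_pi a).
Proof.
apply/Uq_piP; rewrite -scalerBr -mulr_algl -[X in X \in _]mulr1.
exact/Uq_ideal_mul/Uq_pi_repr.
Qed.

Fact Uq_mulA : associative Uq_mul.
Proof.
move=> u v w; have [a ->] := Uq_pi_surj u; have [b ->] := Uq_pi_surj v.
have [c ->] := Uq_pi_surj w.
by rewrite -!Uq_pi_mul mulrA.
Qed.

Fact Uq_mul1 : left_id Uq_one Uq_mul.
Proof. by move=> u; have [a ->] := Uq_pi_surj u; rewrite -Uq_pi_mul mul1r. Qed.

Fact Uq_mulr1 : right_id Uq_one Uq_mul.
Proof. by move=> u; have [a ->] := Uq_pi_surj u; rewrite -Uq_pi_mul mulr1. Qed.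

Fact Uq_mulDl : left_distributive Uq_mul +%R.
Proof.
move=> u v w; have [a ->] := Uq_pi_surj u; have [b ->] := Uq_pi_surj v.
have [c ->] := Uq_pi_surj w.
by rewrite -Uq_pi_add -!Uq_pi_mul mulrDl Uq_pi_add.
Qed.

Fact Uq_mulDr : right_distributive Uq_mul +%R.
Proof.
move=> u v w; have [a ->] := Uq_pi_surj u; have [b ->] := Uq_pi_surj v.
have [c ->] := Uq_pi_surj w.
by rewrite -Uq_pi_add -!Uq_pi_mul mulrDr Uq_pi_add.
Qed.

Lemma Uq_pi0 : Uq_pi 0 = 0.
Proof. by apply: (addrI (Uq_pi 0)); rewrite -Uq_pi_add !addr0. Qed.

Fact Uq_one_neq0 : Uq_one != 0.
Proof.
apply: contra Uq_ideal1 => /eqP; rewrite -Uq_pi0 => /Uq_piP.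
by rewrite subr0.
Qed.

HB.instance Definition _ := GRing.Zmodule_isNzRing.Build U
  Uq_mulA Uq_mul1 Uq_mulr1 Uq_mulDl Uq_mulDr Uq_one_neq0.

Fact Uq_scaleA c d u : Uq_scale c (Uq_scale d u) = Uq_scale (c * d) u.
Proof. by have [a ->] := Uq_pi_surj u; rewrite -!Uq_pi_scale scalerA. Qed.

Fact Uq_scale1 : left_id 1 Uq_scale.
Proof.
by move=> u; have [a ->] := Uq_pi_surj u; rewrite -Uq_pi_scale scale1r.
Qed.

Fact Uq_scaleDr : right_distributive Uq_scale +%R.
Proof.
move=> c u v; have [a ->] := Uq_pi_surj u; have [b ->] := Uq_pi_surj v.
by rewrite -Uq_pi_add -!Uq_pi_scale scalerDr Uq_pi_add.
Qed.

Fact Uq_scaleDl u : {morph Uq_scale^~ u : c d / c + d}.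
Proof.
move=> c d; have [a ->] := Uq_pi_surj u.
by rewrite -!Uq_pi_scale scalerDl Uq_pi_add.
Qed.

HB.instance Definition _ := GRing.Zmodule_isLmodule.Build K U
  Uq_scaleA Uq_scale1 Uq_scaleDr Uq_scaleDl.

Fact Uq_scaleAl (c : K) (u v : U) : c *: (u * v) = (c *: u) * v.
Proof.
have [a ->] := Uq_pi_surj u; have [b ->] := Uq_pi_surj v.
by rewrite /GRing.scale /GRing.mul /= -!(Uq_pi_mul, Uq_pi_scale) -scalerAl.
Qed.

Fact Uq_scaleAr (c : K) (u v : U) : c *: (u * v) = u * (c *: v).
Proof.
have [a ->] := Uq_pi_surj u; have [b ->] := Uq_pi_surj v.
by rewrite /GRing.scale /GRing.mul /= -!(Uq_pi_mul, Uq_pi_scale) -scalerAr.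
Qed.

HB.instance Definition _ := GRing.Lmodule_isLalgebra.Build K U Uq_scaleAl.
HB.instance Definition _ := GRing.Lalgebra_isAlgebra.Build K U Uq_scaleAr.

Fact Uq_pi_is_additive : zmod_morphism Uq_pi.
Proof.
move=> a b; apply: (addIr (Uq_pi b)).
by rewrite -Uq_pi_add !subrK.
Qed.
HB.instance Definition _ :=
  GRing.isZmodMorphism.Build (freealg K 4) U Uq_pi Uq_pi_is_additive.

Fact Uq_pi_is_multiplicative : monoid_morphism Uq_pi.
Proof. by split; [exact: (erefl Uq_one) | exact: Uq_pi_mul]. Qed.
HB.instance Definition _ :=
  GRing.isMonoidMorphism.Build (freealg K 4) U Uq_pi Uq_pi_is_multiplicative.

Fact Uq_pi_is_scalable : scalable Uq_pi.
Proof. by move=> c a; exact: Uq_pi_scale. Qed.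
HB.instance Definition _ :=
  GRing.isScalable.Build K (freealg K 4) U *:%R Uq_pi Uq_pi_is_scalable.

Definition Uq_x : U := Uq_pi (letter K (inord 0)).
Definition Uq_y : U := Uq_pi (letter K (inord 1)).
Definition Uq_yinv : U := Uq_pi (letter K (inord 2)).
Definition Uq_z : U := Uq_pi (letter K (inord 3)).

Definition nu_x : U := q *: (1 - Uq_y * Uq_z).
Definition nu_y : U := q *: (1 - Uq_z * Uq_x).
Definition nu_z : U := q *: (1 - Uq_x * Uq_y).

Lemma Uq_relators0 :
  Uq_relators Uq_x Uq_y Uq_yinv Uq_z = [:: 0; 0; 0; 0; 0].
Proof.
rewrite -(morph_relators Uq_pi) -/Uq_presentation.
suff -> : map Uq_pi Uq_presentation = map (fun=> 0) Uq_presentation by [].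
apply/eq_in_map => r rP; rewrite -Uq_pi0; apply/Uq_piP; rewrite subr0.
exact/asboolP/tsi_gen.
Qed.

Lemma Uq_yyinv : Uq_y * Uq_yinv = 1.
Proof. by case: Uq_relators0 => /subr0_eq. Qed.

Lemma Uq_yinvy : Uq_yinv * Uq_y = 1.
Proof. by case: Uq_relators0 => _ /subr0_eq. Qed.

Lemma Uq_xy : q_comm Uq_x Uq_y = 1.
Proof. by case: Uq_relators0 => _ _ /subr0_eq. Qed.

Lemma Uq_yz : q_comm Uq_y Uq_z = 1.
Proof. by case: Uq_relators0 => _ _ _ /subr0_eq. Qed.

Lemma Uq_zx : q_comm Uq_z Uq_x = 1.
Proof. by case: Uq_relators0 => _ _ _ _ /subr0_eq. Qed.

Lemma q_comm_swap (A : algType K) (a b : A) :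
  q_comm a b = 1 -> q *: (1 - a * b) = q^-1 *: (1 - b * a).
Proof.
move=> /(congr1 ( *:%R (q - q^-1))).
rewrite /q_comm scalerA divff ?q_sub_inv_neq0 // scale1r scalerBl => e.
apply/eqP; rewrite !scalerBr -subr_eq0 opprB [X in _ + X]addrC addrACA -e.
by rewrite [X in _ + X]addrC addrA subrK subrr.
Qed.

Lemma nu_xE : nu_x = q^-1 *: (1 - Uq_z * Uq_y).
Proof. exact/q_comm_swap/Uq_yz. Qed.

Lemma nu_yE : nu_y = q^-1 *: (1 - Uq_x * Uq_z).
Proof. exact/q_comm_swap/Uq_zx. Qed.

Lemma nu_zE : nu_z = q^-1 *: (1 - Uq_y * Uq_x).
Proof. exact/q_comm_swap/Uq_xy. Qed.

Section UniversalProperty.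
Variables (A : algType K) (x y yi z : A).
Hypothesis rel0 : forall r, r \in Uq_relators x y yi z -> r = 0.

Let gens (i : 'I_4) : A := tnth [tuple x; y; yi; z] i.

Let gensE : (gens (inord 0) = x) * (gens (inord 1) = y)
            * (gens (inord 2) = yi) * (gens (inord 3) = z).
Proof. by rewrite /gens !(tnth_nth 0) /= !inordK. Qed.

Definition Uq_lift (u : U) : A := fa_eval gens (repr u).

Lemma Uq_lift_pi a : Uq_lift (Uq_pi a) = fa_eval gens a.
Proof.
apply/esym/subr0_eq; rewrite -raddfB; apply: fa_eval_ideal (Uq_pi_repr a).
by rewrite !gensE.
Qed.

Fact Uq_lift_is_additive : zmod_morphism Uq_lift.
Proof.
move=> u v; have [a ->] := Uq_pi_surj u; have [b ->] := Uq_pi_surj v.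
by rewrite -raddfB !Uq_lift_pi raddfB.
Qed.
HB.instance Definition _ :=
  GRing.isZmodMorphism.Build U A Uq_lift Uq_lift_is_additive.

Fact Uq_lift_is_multiplicative : monoid_morphism Uq_lift.
Proof.
split=> [|u v]; first by rewrite -(rmorph1 Uq_pi) Uq_lift_pi rmorph1.
have [a ->] := Uq_pi_surj u; have [b ->] := Uq_pi_surj v.
by rewrite -rmorphM !Uq_lift_pi rmorphM.
Qed.
HB.instance Definition _ :=
  GRing.isMonoidMorphism.Build U A Uq_lift Uq_lift_is_multiplicative.

Fact Uq_lift_is_scalable : scalable Uq_lift.
Proof.
move=> c u; have [a ->] := Uq_pi_surj u.
by rewrite -(linearZ_LR Uq_pi) !Uq_lift_pi linearZ_LR.
Qed.
HB.instance Definition _ :=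
  GRing.isScalable.Build K U A *:%R Uq_lift Uq_lift_is_scalable.

Lemma Uq_lift_gens :
  [/\ Uq_lift Uq_x = x, Uq_lift Uq_y = y,
      Uq_lift Uq_yinv = yi & Uq_lift Uq_z = z].
Proof. by rewrite !Uq_lift_pi !fa_eval_letter !gensE. Qed.

End UniversalProperty.

End Uq.

(* Main.v *)
Require Import Defs.
From mathcomp Require Import all_boot all_order all_algebra.

Import GRing.Theory.

Local Open Scope ring_scope.

(** The relations hold because each [nu] q-commutes with the two generators
    whose q-commutator it measures.  If [q_comm q a b = 1], then
    [v = q *: (1 - a * b)] is also [q^-1 *: (1 - b * a)], and comparing
    [a * (1 - b * a)] with [(1 - a * b) * a] gives [v * a = q ^+ 2 *: (a * v)];
    likewise [b * v = q ^+ 2 *: (v * b)].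

    Write [x], [y], [z] for the generators and [nu_x = q^-1 *: (1 - z * y)].
    In [x ^+ 2 * (z * y)] the inner product [x * z] is [1 - q *: nu_y]; moving
    [nu_y] left past [x] leaves [(1 - q ^+ 3 *: nu_y) * (x * y)], and
    [x * y = 1 - q^-1 *: nu_z].  In [(z * y) * x ^+ 2] the inner product [y * x]
    is [1 - q *: nu_z]; moving [nu_z] right past [x] leaves
    [(z * x) * (1 - q ^+ 3 *: nu_z)], and [z * x = 1 - q^-1 *: nu_y].  Expanding
    these factorizations gives the first and fourth relations ([sqr_mul_nu] and
    [nu_mul_sqr]).  The three q-commutator relations are permuted by the
    rotation [x -> y -> z -> x], which yields the other four. *)

Section QCommutation.

Set Implicit Arguments.
Unset Strict Implicit.

Variables (K : fieldType) (q : K) (hq : q != 0) (hq2 : q ^+ 2 != 1).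
Variable A : algType K.
Implicit Types a b c : A.

(** For the cyclic pairs of generators of [U_q(sl_2)] this is
    [nu_x = nu q y z], [nu_y = nu q z x] and [nu_z = nu q x y]. *)
Definition nu a b : A := q *: (1 - a * b).

Lemma mul_nu a b : a * b = 1 - q^-1 *: nu a b.
Proof. by rewrite /nu scalerA mulVf // scale1r subKr. Qed.

Lemma mul_nu_swap a b : q_comm q a b = 1 -> b * a = 1 - q *: nu a b.
Proof.
move=> /(q_comm_swap hq hq2) e.
by rewrite /nu e scalerA divff // scale1r subKr.
Qed.

(** Both sides are multiples of [a - a * b * a], with [nu a b] written as
    [q *: (1 - a * b)] on the left and as [q^-1 *: (1 - b * a)] on the right;
    the ratio of the two scalars is [q ^+ 2]. *)
Lemma nu_q_commute_l a b :
  q_comm q a b = 1 -> nu a b * a = q ^+ 2 *: (a * nu a b).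
Proof.
move=> /(q_comm_swap hq hq2) e; rewrite {2}/nu e /nu -scalerAl -scalerAr scalerA.
by rewrite expr2 mulfK // mulrBl mulrBr mul1r mulr1 mulrA.
Qed.

Lemma nu_q_commute_r a b :
  q_comm q a b = 1 -> b * nu a b = q ^+ 2 *: (nu a b * b).
Proof.
move=> /(q_comm_swap hq hq2) e; rewrite {2}/nu e /nu -scalerAl -scalerAr scalerA.
by rewrite expr2 mulfK // mulrBl mulrBr mul1r mulr1 mulrA.
Qed.

(** The inner product [a * c] is [1 - q *: nu c a]; moving [nu c a] to the left
    of the remaining [a] turns the coefficient [q] into [q ^+ 3] and leaves
    [a * b = 1 - q^-1 *: nu a b] on the right. *)
Lemma sqr_mul_swap a b c : q_comm q c a = 1 ->
  a ^+ 2 * (c * b) = (1 - q ^+ 3 *: nu c a) * (1 - q^-1 *: nu a b).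
Proof.
move=> ca; rewrite expr2 -mulrA [a * (c * b)]mulrA (mul_nu_swap ca) mulrA.
rewrite mulrBr mulr1 -scalerAr (nu_q_commute_r ca) scalerA -exprS.
by rewrite -mul_nu mulrA [(1 - _) * a]mulrBl mul1r scalerAl.
Qed.

(** The mirror computation: the inner product is now [b * a], and it is [nu a b]
    that moves right past [a], so the factor [q ^+ 3] changes sides.  This is
    the source of the exchange of [q ^+ 2] and [q ^- 2] between [sqr_mul_nu] and
    [nu_mul_sqr]. *)
Lemma swap_mul_sqr a b c : q_comm q a b = 1 ->
  (c * b) * a ^+ 2 = (1 - q^-1 *: nu c a) * (1 - q ^+ 3 *: nu a b).
Proof.
move=> ab; rewrite expr2 mulrA -[c * b * a]mulrA (mul_nu_swap ab) -mulrA.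
rewrite mulrBl mul1r -scalerAl (nu_q_commute_l ab) scalerA -exprS.
by rewrite -mul_nu -mulrA [a * (1 - _)]mulrBr mulr1 scalerAr.
Qed.

(** Expansion of [sqr_mul_swap], [nu b c] being [q^-1 *: (1 - c * b)]. *)
Lemma sqr_mul_nu a b c : q_comm q b c = 1 -> q_comm q c a = 1 ->
  a ^+ 2 * nu b c = q^-1 *: a ^+ 2 - q^-1%:A + q ^+ 2 *: nu c a
                    + q ^- 2 *: nu a b - q *: (nu c a * nu a b).
Proof.
move=> /(q_comm_swap hq hq2) bc ca; rewrite {1}/nu bc -scalerAr mulrBr mulr1.
rewrite sqr_mul_swap // mulrBl mul1r mulrBr mulr1 -scalerAl -scalerAr.
rewrite !(scalerBr, opprB) !scalerA.
have -> : q^-1 * q ^+ 3 = q ^+ 2 by rewrite exprS mulKf.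
have -> : q^-1 * q^-1 = q ^- 2 by rewrite -invfM.
have -> : q ^+ 2 * q^-1 = q by rewrite expr2 mulfK.
by rewrite (AC (1 * (2 * 2)) (1 * 5 * 2 * 4 * 3)).
Qed.

Lemma nu_mul_sqr a b c : q_comm q b c = 1 -> q_comm q a b = 1 ->
  nu b c * a ^+ 2 = q^-1 *: a ^+ 2 - q^-1%:A + q ^- 2 *: nu c a
                    + q ^+ 2 *: nu a b - q *: (nu c a * nu a b).
Proof.
move=> /(q_comm_swap hq hq2) bc ab; rewrite {1}/nu bc -scalerAl mulrBl mul1r.
rewrite swap_mul_sqr // mulrBr mulr1 mulrBl mul1r -scalerAl -scalerAr.
rewrite !(scalerBr, opprB) !scalerA.
have -> : q^-1 * q ^+ 3 = q ^+ 2 by rewrite exprS mulKf.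
have -> : q^-1 * q^-1 = q ^- 2 by rewrite -invfM.
have -> : q ^- 2 * q ^+ 3 = q by rewrite [q ^+ 3]exprSr mulKf ?expf_neq0.
by rewrite (AC (1 * (2 * 2)) (1 * 5 * 4 * 2 * 3)).
Qed.

End QCommutation.

Theorem lemma3p6 (K : fieldType) (q : K) (hq : q != 0) (hq2 : q ^+ 2 != 1) :
  let x := Uq_x hq hq2 in
  let y := Uq_y hq hq2 in
  let z := Uq_z hq hq2 in
  let nx := nu_x hq hq2 in
  let ny := nu_y hq hq2 in
  let nz := nu_z hq hq2 in
  x ^+ 2 * nx = q^-1 *: x ^+ 2 - q^-1%:A + q ^+ 2 *: ny + q ^- 2 *: nz
                - q *: (ny * nz)
  /\ y ^+ 2 * ny = q^-1 *: y ^+ 2 - q^-1%:A + q ^+ 2 *: nz + q ^- 2 *: nx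
                - q *: (nz * nx)
  /\ z ^+ 2 * nz = q^-1 *: z ^+ 2 - q^-1%:A + q ^+ 2 *: nx + q ^- 2 *: ny
                - q *: (nx * ny)
  /\ nx * x ^+ 2 = q^-1 *: x ^+ 2 - q^-1%:A + q ^- 2 *: ny + q ^+ 2 *: nz
                - q *: (ny * nz)
  /\ ny * y ^+ 2 = q^-1 *: y ^+ 2 - q^-1%:A + q ^- 2 *: nz + q ^+ 2 *: nx
                - q *: (nz * nx)
  /\ nz * z ^+ 2 = q^-1 *: z ^+ 2 - q^-1%:A + q ^- 2 *: nx + q ^+ 2 *: ny
                - q *: (nx * ny).
Proof.
move=> x y z nx ny nz.
have xy : q_comm q x y = 1 := Uq_xy hq hq2.
have yz : q_comm q y z = 1 := Uq_yz hq hq2.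
have zx : q_comm q z x = 1 := Uq_zx hq hq2.
split; first exact (sqr_mul_nu hq hq2 yz zx).
split; first exact (sqr_mul_nu hq hq2 zx xy).
split; first exact (sqr_mul_nu hq hq2 xy yz).
split; first exact (nu_mul_sqr hq hq2 yz xy).
split; first exact (nu_mul_sqr hq hq2 zx yz).
exact (nu_mul_sqr hq hq2 xy zx).
Qed.
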